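(* For any positive integers $n,k_1,\dots,k_n$ with $k_1\ge2$, \begin{align*} &\sum_{i=1}^n\bigl[1+(k_i+\delta_{ni}-2)t\bigr]\zeta^t(k_1,\dots,k_{i-1},k_i+1,k_{i+1},\dots,k_n)\\ &=\sum_{i=1}^n\sum_{j=2}^{k_i}\zeta^t(k_1,\dots,k_{i-1},j,k_i+1-j,k_{i+1},\dots,k_n)\\ &\quad+(t-t^2)\sum_{i=1}^{n-1}\zeta^t(k_1,\dots,k_{i-1},k_i+k_{i+1}+1,k_{i+2},\dots,k_n), \end{align*} where $\delta_{ni}$ is the Kronecker delta.
   Context: For positive integers $k_1\ge2,k_2,\dots,k_n$, the multiple zeta value is $\zeta(k_1,\dots,k_n)=\sum_{m_1>\cdots>m_n>0}m_1^{-k_1}\cdots m_n^{-k_n}$. For an indeterminate (or real number) $t$, the interpolated multiple zeta value is $\zeta^t(k_1,\dots,k_n)=\sum_{\mathbf p}t^{n-\operatorname{dep}(\mathbf p)}\zeta(\mathbf p)$, where $\mathbf p$ runs over all indices obtained from $(k_1\Box k_2\Box\cdots\Box k_n)$ by filling each $\Box$ with either a comma or a plus sign, and $\operatorname{dep}(\mathbf p)$ is the number of entries of $\mathbf p$. *)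

(* Defs.v *)
From HB Require Import structures.
From mathcomp Require Import all_boot all_order all_algebra.
From mathcomp Require Import all_classical all_reals all_analysis.

Set Implicit Arguments.
Unset Strict Implicit.
Unset Printing Implicit Defensive.

Import Order.TTheory GRing.Theory Num.Theory.

Local Open Scope classical_set_scope.
Local Open Scope ring_scope.

Definition mzv_domain (n : nat) : set (n.-tuple nat) :=
  [set m | sorted gtn m /\ all (leq 1) m].
Arguments mzv_domain : clear implicits.

(* The terms are nonnegative, so the multiple series is the unordered sum    *)
(* in [0, +oo].  For a divergent index (k_1 = 1) [fine] returns 0; only      *)
(* indices with k_1 >= 2 are meaningful.                                     *)
Definition mzv (R : realType) (k : seq nat) : R :=
  fine (\esum_(m in mzv_domain (size k))
          (\prod_(i < size k) (tnth m i)%:R ^- nth 0%N k i)%:E)%E.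

(* [fill_boxes a s b] fills the boxes of (a [] s_1 [] s_2 [] ...) according  *)
(* to b: [true] is a comma, [false] a plus sign.                             *)
Fixpoint fill_boxes (a : nat) (s : seq nat) (b : seq bool) : seq nat :=
  match s, b with
  | a' :: s', true :: b' => a :: fill_boxes a' s' b'
  | a' :: s', false :: b' => fill_boxes (a + a') s' b'
  | _, _ => a :: s
  end.

Definition fill (k : seq nat) (b : seq bool) : seq nat :=
  if k is a :: s then fill_boxes a s b else [::].

(* t ranges over a commutative R-algebra: A = {poly R} with t = 'X is the    *)
(* indeterminate, A = R^o is a real t.                                       *)
Definition interpolated_mzv (R : realType) (A : comAlgType R) (t : A)
    (k : seq nat) : A :=
  \sum_(b : (size k).-1.-tuple bool)
     mzv R (fill k b) *: t ^+ (size k - size (fill k b)).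

(* Main.v *)
(* Let H f k = sum_i f(k + e_i) - sum_(i, 2 <= j <= k_i) f(..., j, k_i+1-j, ...),
   so that Hoffman's relation (the case t = 0) reads H zeta k = 0.

   Truncate all sums at m_1 < M.  Writing h for the harmonic numbers, the
   partial fraction expansion of sum_j n^-j m^-(k+1-j) makes the sums over the
   new variable telescope, and by induction on k,
     H zeta_M k = sum_(m_1 < M) (m_1^-k_1 ... m_n^-k_n)(h_(M-1) - h_(M-1-m_1)).
   Since h_(M-1) - h_(M-1-m) <= m/(M-m) and k_1 >= 2, the right-hand side is at
   most 2 h_(M-1)^n / M, which tends to 0.

   For general t, summing H f over all fillings of the boxes of k with weights
   t^(n - dep) is, for every function f on indices, the difference of the two
   sides of the theorem with zeta replaced by f. *)

Require Import Defs.
From HB Require Import structures.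
From mathcomp Require Import all_boot all_order all_algebra.
From mathcomp Require Import all_classical all_reals all_analysis.
From mathcomp Require Import ring zify.

Set Implicit Arguments.
Unset Strict Implicit.
Unset Printing Implicit Defensive.

Import Order.TTheory GRing.Theory Num.Theory.
Import numFieldNormedType.Exports.

Local Open Scope ring_scope.

(** * Operations on indices *)

Section WordSums.
Variable V : zmodType.
Implicit Types (f g : seq nat -> V) (s : seq nat).

(** The prefix already passed is absorbed into [f] as [f \o cons a], so inductions on the index
    quantify over [f]. *)
Fixpoint bump_sum f s : V :=
  if s is a :: s' then f (a.+1 :: s') + bump_sum (f \o cons a) s' else 0.

(** As [j <= a], the subtraction is exact and the second entry is positive. *)
Definition head_split f a s : V :=
  \sum_(2 <= j < a.+1) f [:: j, (a.+1 - j)%N & s].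

Fixpoint split_sum f s : V :=
  if s is a :: s' then head_split f a s' + split_sum (f \o cons a) s' else 0.

Fixpoint merge_sum f s : V :=
  if s is a :: s' then
    (if s' is b :: s'' then f ((a + b).+1 :: s'') else 0)
    + merge_sum (f \o cons a) s'
  else 0.

End WordSums.

(** The effect of a plus sign in the box between [a] and a nonempty index; the value at the empty
    word is a placeholder. *)
Definition add_head a s : seq nat :=
  if s is b :: s' then (a + b)%N :: s' else [::].

(** * Reduction of the interpolated relation to Hoffman's relation *)

Section Interpolation.
Variables (A : comNzRingType) (t : A).
Implicit Types (f g : seq nat -> A) (a : nat) (s : seq nat).

(* [interp_from f a s] sums f over the fillings of (a [] s_1 [] s_2 [] ...),
   weighted by t^(number of plus signs). *)
Fixpoint interp_from f a s : A :=
  if s is b :: s' then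
    interp_from (f \o cons a) b s' + t * interp_from f (a + b) s'
  else f [:: a].

Definition interp f s : A := if s is a :: s' then interp_from f a s' else 0.

(** The test [s' == [::]] recognises the last entry: it is the Kronecker delta. *)
Fixpoint weighted_bump_sum f s : A :=
  if s is a :: s' then
    (1 + (a%:R + (s' == [::])%:R - 2) * t) * f (a.+1 :: s')
    + weighted_bump_sum (f \o cons a) s'
  else 0.

(** Left side minus right side of the theorem, with [f] in place of the interpolated zeta value. *)
Definition defect f s : A :=
  weighted_bump_sum f s - split_sum f s - (t - t ^+ 2) * merge_sum f s.

Lemma interp_fromB f g a s :
  interp_from (fun w => f w - g w) a s = interp_from f a s - interp_from g a s.
Proof.
elim: s f g a => [|b s IHs] f g a //=.
rewrite (IHs f g (a + b)%N) mulrBr opprD addrACA; congr (_ + _).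
exact: (IHs (f \o cons a) (g \o cons a)).
Qed.

Lemma interp_from_sum (I : Type) (r : seq I) (F : I -> seq nat -> A) a s :
  interp_from (fun w => \sum_(i <- r) F i w) a s =
  \sum_(i <- r) interp_from (F i) a s.
Proof.
elim: s a F => [|b s IHs] a F //=.
rewrite (IHs (a + b)%N) mulr_sumr [RHS]big_split/=; congr (_ + _).
exact: (IHs b (fun i => F i \o cons a)).
Qed.

(** The empty word is excluded because the recursion for [interp], written with [add_head], fails
    there. *)
Lemma eq_defect f g s :
  (forall a w, f (a :: w) = g (a :: w)) -> defect f s = defect g s.
Proof.
move=> fg; rewrite /defect; congr (_ - _ - _ * _).
- elim: s f g fg => //= a s IHs f g fg; congr (_ * _ + _) => //.
  by apply: IHs => b w /=.
- elim: s f g fg => //= a s IHs f g fg; congr (_ + _).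
    by apply: eq_bigr => j _.
  by apply: IHs => b w /=.
- elim: s f g fg => //= a s IHs f g fg; congr (_ + _); first by case: s {IHs}.
  by apply: IHs => b w /=.
Qed.

Lemma defectD f g s :
  defect (fun w => f w + t * g w) s = defect f s + t * defect g s.
Proof.
have wD : weighted_bump_sum (fun w => f w + t * g w) s =
    weighted_bump_sum f s + t * weighted_bump_sum g s.
  elim: s f g => [|a s IHs] f g /=; first by rewrite mulr0 addr0.
  by have /= := IHs (f \o cons a) (g \o cons a); rewrite /comp => ->; ring.
have sD : split_sum (fun w => f w + t * g w) s =
    split_sum f s + t * split_sum g s.
  elim: s f g {wD} => [|a s IHs] f g /=; first by rewrite mulr0 addr0.
  have /= := IHs (f \o cons a) (g \o cons a); rewrite /comp => ->.
  by rewrite /head_split/= big_split/= -mulr_sumr; ring.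
have mD : merge_sum (fun w => f w + t * g w) s =
    merge_sum f s + t * merge_sum g s.
  elim: s f g {wD sD} => [|a s IHs] f g /=; first by rewrite mulr0 addr0.
  have /= := IHs (f \o cons a) (g \o cons a); rewrite /comp => ->.
  by case: s {IHs} => [|b s]; ring.
by rewrite /defect wD sD mD; ring.
Qed.

Lemma defect_cons2 f a b s :
  defect f [:: a, b & s] =
  (1 + (a%:R - 2) * t) * f [:: a.+1, b & s] - head_split f a (b :: s)
  - (t - t ^+ 2) * f ((a + b).+1 :: s) + defect (f \o cons a) (b :: s).
Proof. by rewrite /defect /= addr0; ring. Qed.

(** The cut of a + b + 1 at j falls before, at or after a + 1; in the last case it is a cut of b + 1
    whose first part is enlarged by a. *)
Lemma head_splitD f a b s : (0 < a)%N -> (0 < b)%N ->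
  head_split f (a + b) s =
  \sum_(2 <= j < a.+1) f [:: j, ((a + b).+1 - j)%N & s]
  + f [:: a.+1, b & s] + head_split (f \o add_head a) b s.
Proof.
move=> a0 b0; rewrite /head_split.
rewrite (@big_cat_nat _ _ _ a.+1) ?ltnS ?leq_addr//= -addrA; congr (_ + _).
rewrite big_ltn; last by lia.
have -> : ((a + b).+1 - a.+1 = b)%N by lia.
have -> : (a.+2 = 2 + a)%N by lia.
rewrite big_addn; congr (_ + _).
have -> : ((a + b).+1 - a = b.+1)%N by lia.
rewrite !big_nat; apply: eq_bigr => j /andP[_ jb].
by rewrite addnC; congr (f [:: _, _ & _]); lia.
Qed.

(** Adding a after the operations instead of before lowers the weight of the bumped head by a t and
    loses the cuts with j at most a + 1. *)
Lemma defect_add_head f a b s : (0 < a)%N -> (0 < b)%N ->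
  defect (f \o add_head a) (b :: s) =
  defect f ((a + b)%N :: s) - a%:R * t * f ((a + b).+1 :: s)
  + \sum_(2 <= j < a.+1) f [:: j, ((a + b).+1 - j)%N & s]
  + f [:: a.+1, b & s].
Proof.
move=> a0 b0; rewrite /defect/= head_splitD// /comp/= addnS natrD.
have <- : (if s is c :: s' then f ((a + (b + c)).+1 :: s') else 0) =
  if s is c :: s' then f ((a + b + c).+1 :: s') else 0.
  by case: s => // c s; rewrite addnA.
case: s => [|c s]; rewrite /= ?addnS; ring.
Qed.

(** Induction on the number of boxes: the first box is a comma, leaving [f \o cons a] on the tail,
    or a plus sign, leaving the shorter index with head [a + b]. *)
Lemma defect_interp f s : all (leq 1) s ->
  defect (interp f) s = interp (fun w => bump_sum f w - split_sum f w) s.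
Proof.
case: s => [|a s]; first by move=> _; rewrite /defect/=; ring.
elim: s f a => [|b s IHs] f a.
  move=> /= /andP[a0 _]; rewrite /defect /= !addr0 /head_split/=.
  (* Each of the a - 1 cuts can be merged back; the resulting (a - 1) t cancels the t-part of the
     weight, delta included. *)
  rewrite (eq_big_nat _ _ (F2 := fun j => f [:: j; (a.+1 - j)%N] + t * f [:: a.+1])).
    by rewrite big_split/= sumr_const_nat subSS -(mulr_natl _ (a - 1)) natrB//; ring.
  by move=> j /andP[_ ja]; rewrite subnKC// ltnW.
move=> /= /and3P[a0 b0 s0].
have jE j : (2 <= j < a.+1)%N -> (j + (a.+1 - j) = a.+1)%N by lia.
(* Fillings of the two boxes around a + 1 - j: two commas, comma then plus, and a plus after j,
   which no longer depends on j. *)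
have splitE : head_split (interp f) a (b :: s) =
    \sum_(2 <= j < a.+1) interp_from (f \o cons j \o cons (a.+1 - j)%N) b s
    + t * (\sum_(2 <= j < a.+1) interp_from (f \o cons j) ((a + b).+1 - j) s)
    + (a%:R - 1) * (t * interp_from (f \o cons a.+1) b s +
                    t ^+ 2 * interp_from f (a + b).+1 s).
  rewrite /head_split mulr_sumr.
  have -> : a%:R - 1 = (a.+1 - 2)%:R :> A by rewrite subSS natrB.
  rewrite mulr_natl -sumr_const_nat -!big_split/=; apply: eq_big_nat => j ja.
  rewrite !jE// addSn (_ : (a.+1 - j + b = (a + b).+1 - j)%N); last by lia.
  by ring.
have mergeE : \sum_(2 <= j < a.+1) interp f [:: j, ((a + b).+1 - j)%N & s] =
    \sum_(2 <= j < a.+1) interp_from (f \o cons j) ((a + b).+1 - j) s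
    + (a%:R - 1) * t * interp_from f (a + b).+1 s.
  have -> : a%:R - 1 = (a.+1 - 2)%:R :> A by rewrite subSS natrB.
  rewrite -mulrA mulr_natl -sumr_const_nat -big_split/=.
  apply: eq_big_nat => j ja; congr (_ + _ * interp_from f _ _); lia.
have tailE : defect (interp f \o cons a) (b :: s) =
    interp (fun w => bump_sum (f \o cons a) w - split_sum (f \o cons a) w) (b :: s)
    + t * defect (interp f \o add_head a) (b :: s).
  by rewrite -IHs ?/= ?b0// -defectD; apply: eq_defect.
have headE : interp_from ((fun w => bump_sum f w - split_sum f w) \o cons a) b s =
    interp_from (f \o cons a.+1) b s
    - (\sum_(2 <= j < a.+1) interp_from (f \o cons j \o cons (a.+1 - j)%N) b s
    - interp_from (fun w => bump_sum (f \o cons a) w - split_sum (f \o cons a) w) b s).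
  rewrite -interp_from_sum -!interp_fromB.
  congr interp_from; apply/funext => w /=.
  by rewrite /head_split; ring.
(* The fillings beginning with a + b + 1 get coefficient t + (a-2)t^2 - (a-1)t^2 - (t - t^2) = 0,
   and those beginning with a + 1 and then a comma get 1 + (a-2)t - (a-1)t + t = 1. *)
rewrite defect_cons2 splitE tailE defect_add_head// mergeE IHs/= ?addn_gt0 ?a0//.
by rewrite addSn headE; ring.
Qed.

End Interpolation.

(** * Indexed forms of the recursive sums, and vanishing of interpolated sums *)

Section SumForms.
Variables (A : comNzRingType) (t : A).
Implicit Types (f : seq nat -> A) (k : seq nat).

Lemma weighted_bump_sumE f k :
  weighted_bump_sum t f k =
  \sum_(i < size k)
    (1 + ((nth 0%N k i)%:R + (i.+1 == size k)%:R - 2%:R) * t) *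
    f (take i k ++ [:: (nth 0%N k i + 1)%N] ++ drop i.+1 k).
Proof.
elim: k f => [|a k IHk] f /=; first by rewrite big_ord0.
by rewrite big_ord_recl/= drop0 addn1 IHk eqSS [0%N == _]eq_sym size_eq0.
Qed.

Lemma split_sumE f k :
  split_sum f k =
  \sum_(i < size k) \sum_(2 <= j < (nth 0%N k i).+1)
    f (take i k ++ [:: j; (nth 0%N k i + 1 - j)%N] ++ drop i.+1 k).
Proof.
elim: k f => [|a k IHk] f /=; first by rewrite big_ord0.
rewrite big_ord_recl/= drop0 IHk; congr (_ + _).
by apply: eq_bigr => j _; rewrite addn1.
Qed.

Lemma merge_sumE f k :
  merge_sum f k =
  \sum_(i < (size k).-1)
    f (take i k ++ [:: (nth 0%N k i + nth 0%N k i.+1 + 1)%N] ++ drop i.+2 k).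
Proof.
elim: k f => [|a [|b k] IHk] f; try by rewrite /= ?big_ord0 ?addr0.
by rewrite big_ord_recl/= drop0 addn1; congr (_ + _); apply: IHk.
Qed.

(** Plus signs only enlarge the first entry, so every filling still starts with an entry at least
    [c]. *)
Lemma interp_from_eq0 f c a s : (0 < c <= a)%N -> all (leq 1) s ->
  (forall b w, (c <= b)%N -> all (leq 1) w -> f (b :: w) = 0) ->
  interp_from t f a s = 0.
Proof.
elim: s f c a => [|b s IHs] f c a /andP[c0 ca] /=.
  by move=> _ f0; apply: f0.
move=> /andP[b0 s0] f0; rewrite (IHs (f \o cons a) 1%N)//; last first.
  by move=> d w d0 w0 /=; apply: f0 => //=; rewrite d0.
by rewrite (IHs f c)// ?mulr0 ?addr0// c0 (leq_trans ca) ?leq_addr.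
Qed.

End SumForms.

(** * Interpolated zeta values as weighted sums over fillings *)

Section Algebra.
Variables (R : realType) (A : comAlgType R) (t : A).
Implicit Types (g : seq nat -> R).

Lemma bump_sum_scale g s :
  bump_sum (fun w => (g w)%:A : A) s = (bump_sum g s)%:A.
Proof.
elim: s g => [|a s IHs] g /=; first by rewrite scale0r.
by rewrite scalerDl; congr (_ + _); apply: (IHs (g \o cons a)).
Qed.

Lemma split_sum_scale g s :
  split_sum (fun w => (g w)%:A : A) s = (split_sum g s)%:A.
Proof.
elim: s g => [|a s IHs] g /=; first by rewrite scale0r.
rewrite scalerDl; congr (_ + _); last exact: (IHs (g \o cons a)).
by rewrite /head_split scaler_suml.
Qed.

Lemma size_fill_boxes a s b : (size (fill_boxes a s b) <= (size s).+1)%N.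
Proof.
elim: s a b => [|c s IHs] a [|[] b] //=; first exact: IHs.
exact/leqW/IHs.
Qed.

Lemma sum_fill_boxes g a s :
  \sum_(b : (size s).-tuple bool)
     g (fill_boxes a s b) *: t ^+ ((size s).+1 - size (fill_boxes a s b)) =
  interp_from t (fun w => (g w)%:A) a s.
Proof.
elim: s g a => [|c s IHs] g a /=.
  rewrite (bigD1 [tuple])//= big1 ?addr0//.
  by move=> b /eqP[]; apply: tuple0.
(* Separates the first box from the others. *)
rewrite (reindex (fun p : bool * (size s).-tuple bool =>
  [tuple of p.1 :: p.2]))/=; last first.
  exists (fun b => (thead b, [tuple of behead b])) => [[x b]|b] _ /=.
    by congr pair; apply: val_inj.
  by rewrite -tuple_eta.
rewrite -(pair_big xpredT xpredT (fun x (b : (size s).-tuple bool) =>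
  g (fill_boxes a (c :: s) (x :: b)) *:
    t ^+ ((size s).+2 - size (fill_boxes a (c :: s) (x :: b)))))/=.
rewrite big_bool/=; congr (_ + _).
  exact: (IHs (g \o cons a)).
rewrite -IHs mulr_sumr; apply: eq_bigr => b _.
(* A plus sign lowers the depth by one, whence the extra factor [t]; the size bound keeps the
   subtraction exact. *)
by rewrite subSn ?size_fill_boxes// exprS scalerAr.
Qed.

Lemma interpolated_mzvE k :
  k != [::] -> interpolated_mzv t k = interp t (fun w => (mzv R w)%:A) k.
Proof. by case: k => // a s _; apply: sum_fill_boxes. Qed.

End Algebra.

(** * Hoffman's relation for truncated sums, with an exact error term *)

Section TruncatedHoffman.
Variable F : numFieldType.
Implicit Types (s : seq nat) (a m n M N : nat).

Fixpoint truncated_mzv M s : F :=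
  if s is a :: s' then \sum_(1 <= m < M) m%:R ^- a * truncated_mzv m s' else 1.

Definition harmonic_number n : F := \sum_(1 <= m < n.+1) m%:R^-1.
Local Notation h := harmonic_number.
Local Notation Z := truncated_mzv.

Definition truncation_error M s : F :=
  if s is a :: s' then
    \sum_(1 <= m < M) m%:R ^- a * Z m s' * (h M.-1 - h (M.-1 - m))
  else 0.

Lemma exchange_triangle (V : nmodType) M (f : nat -> nat -> V) :
  \sum_(1 <= n < M) \sum_(1 <= m < n) f n m =
  \sum_(1 <= m < M) \sum_(m.+1 <= n < M) f n m.
Proof.
elim: M => [|[|M] IHM]; [by rewrite !big_geq..|].
rewrite big_nat_recr//= IHM [RHS]big_nat_recr//= [X in _ = _ + X]big_geq// addr0.
rewrite -big_split/=; apply: eq_big_nat => m /andP[_ mM].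
by rewrite [RHS]big_nat_recr.
Qed.

Lemma sum_inv_offset m N : (m < N)%N ->
  \sum_(m.+1 <= n < N) (n - m)%:R^-1 = h (N.-1 - m).
Proof.
move=> mN; rewrite -[m.+1]add1n big_addn /h (_ : (N - m = (N.-1 - m).+1)%N).
  by apply: eq_bigr => i _; rewrite addnK.
by lia.
Qed.

Lemma sum_inv_rev_offset m N : (m < N)%N ->
  \sum_(m.+1 <= n < N) (N - n)%:R^-1 = h (N.-1 - m).
Proof.
move=> mN; rewrite big_nat_rev -sum_inv_offset//; apply: eq_big_nat => n.
by move=> mn; congr (_%:R^-1); lia.
Qed.

Lemma sum_inv_range m N : (m < N)%N ->
  \sum_(m.+1 <= n < N) n%:R^-1 = h N.-1 - h m.
Proof.
move=> mN; rewrite /h prednK ?(leq_ltn_trans _ mN)//.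
by rewrite (@big_cat_nat _ _ _ m.+1 1 N)//= addrAC subrr add0r.
Qed.

(** A geometric sum of ratio m/n. The first part of the result telescopes when summed over n > m;
    the second becomes a convolution over m < n. *)
Lemma sum_partial_fractions a m n : (0 < a)%N -> (0 < m < n)%N ->
  \sum_(2 <= j < a.+1) n%:R ^- j * m%:R ^- (a.+1 - j) =
  m%:R ^- a * ((n - m)%:R^-1 - n%:R^-1) - n%:R ^- a * (n - m)%:R^-1 :> F.
Proof.
move=> + /andP[m0 mn]; have n0 := ltn_trans m0 mn.
have mR : m%:R != 0 :> F by rewrite pnatr_eq0 -lt0n.
have nR : n%:R != 0 :> F by rewrite pnatr_eq0 -lt0n.
have nmR : n%:R - m%:R != 0 :> F.
  by rewrite -natrB ?(ltnW mn)// pnatr_eq0 -lt0n subn_gt0.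
rewrite natrB ?(ltnW mn)//; case: a => // a _; elim: a => [|a IHa].
  by rewrite big_geq// !expr1; field; apply/and3P.
rewrite big_nat_recr//= subSn// subnn expr1.
rewrite (eq_big_nat _ _ (F2 := fun j => n%:R ^- j * m%:R ^- (a.+2 - j) * m%:R^-1)).
  rewrite -mulr_suml IHa !exprS.
  by field; rewrite ?expf_neq0// nmR mR nR.
move=> j /andP[_ ja]; rewrite -mulrA; congr (_ * _).
by rewrite subSn 1?ltnW// exprSr invfM.
Qed.

(** With outermost variable l, summing 1/(N - m) over l < m < N gives h_(N-1-l); the error term
    supplies the missing h_(N-1) - h_(N-1-l). *)
Lemma truncated_mzv_convolution N s : (0 < N)%N ->
  \sum_(1 <= m < N) Z m s * (N - m)%:R^-1 + truncation_error N s =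
  Z N s * h N.-1.
Proof.
move=> N0; case: s => [|b s] /=.
  under eq_bigr do rewrite mul1r.
  by rewrite addr0 mul1r sum_inv_rev_offset// subn0.
under eq_bigr do rewrite mulr_suml.
rewrite exchange_triangle mulr_suml -big_split/=; apply: eq_big_nat => l.
by move=> /andP[_ lN]; rewrite -mulr_sumr sum_inv_rev_offset//; ring.
Qed.

(** Linearity of the Hoffman operator lets it pass under the sum over the outermost variable. *)
Lemma bump_split_sum_mull (f : nat -> seq nat -> F) (c : nat -> F) M s :
  let g w := \sum_(1 <= m < M) c m * f m w in
  bump_sum g s - split_sum g s =
  \sum_(1 <= m < M) c m * (bump_sum (f m) s - split_sum (f m) s).
Proof.
elim: s f => [|a s IHs] f /=.
  by rewrite subrr big1// => m _; rewrite mulr0.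
rewrite opprD addrACA [X in _ + X](IHs (fun m => f m \o cons a)).
rewrite /head_split exchange_big/= -sumrB -big_split/=.
by apply: eq_bigr => m _; rewrite -mulr_sumr; ring.
Qed.

Lemma head_split_truncated M a s : (0 < a)%N ->
  head_split (Z M) a s =
  \sum_(1 <= m < M) m%:R ^- a * Z m s * (h (M.-1 - m) - h M.-1 + h m)
  - \sum_(1 <= n < M) n%:R ^- a * \sum_(1 <= m < n) Z m s * (n - m)%:R^-1.
Proof.
move=> a0; rewrite /head_split/= exchange_big/=.
have -> : \sum_(1 <= m < M) m%:R ^- a * Z m s * (h (M.-1 - m) - h M.-1 + h m) =
    \sum_(1 <= n < M) \sum_(1 <= m < n)
      m%:R ^- a * Z m s * ((n - m)%:R^-1 - n%:R^-1).
  rewrite exchange_triangle; apply: eq_big_nat => m /andP[_ mM].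
  by rewrite -mulr_sumr sumrB sum_inv_offset// sum_inv_range//; ring.
rewrite -sumrB; apply: eq_bigr => n _.
rewrite mulr_sumr -sumrB.
under eq_bigr do rewrite mulr_sumr.
rewrite exchange_big/=; apply: eq_big_nat => m mn.
under eq_bigr do rewrite mulrA.
by rewrite -mulr_suml sum_partial_fractions//; ring.
Qed.

Lemma truncated_hoffman M s : all (leq 1) s ->
  bump_sum (Z M) s - split_sum (Z M) s = truncation_error M s.
Proof.
elim: s M => [|a s IHs] M /=; first by rewrite subrr.
move=> /andP[a0 s0].
rewrite opprD addrACA [X in _ + X](bump_split_sum_mull Z (fun m => m%:R ^- a)).
under [X in _ + X]eq_bigr do rewrite IHs//.
rewrite head_split_truncated//.
transitivity (\sum_(1 <= m < M) (m%:R ^- a.+1 * Z m s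
    - (m%:R ^- a * Z m s * (h (M.-1 - m) - h M.-1 + h m)
       - m%:R ^- a * \sum_(1 <= l < m) Z l s * (m - l)%:R^-1)
    + m%:R ^- a * truncation_error m s)).
  by rewrite big_split/= !sumrB.
apply: eq_big_nat => -[|m] // mM.
(* The convolution equals Z h_(m-1) minus an error that cancels the inductive one; the rest of the
   bumped term cancels by h_m - h_(m-1) = 1/m. *)
have /(canRL (addrK _)) -> := @truncated_mzv_convolution m.+1 s isT.
have -> : h m.+1 = h m + m.+1%:R^-1 by rewrite /h big_nat_recr.
by rewrite /= exprS invfM; ring.
Qed.

End TruncatedHoffman.

(** * Bounds for truncated sums and for the error *)

Section HarmonicBounds.
Variable F : numFieldType.
Implicit Types (s : seq nat) (a k m n M N : nat).
Local Notation h := (@harmonic_number F).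
Local Notation Z := (@truncated_mzv F).

Lemma truncated_mzv_ge0 M s : 0 <= Z M s.
Proof.
elim: s M => //= a s IHs M; apply: sumr_ge0 => m _.
by rewrite mulr_ge0// invr_ge0 exprn_ge0.
Qed.

Lemma le_truncated_mzv M N s : (M <= N)%N -> Z M s <= Z N s.
Proof.
case: s => // a s; case: M => [|M] MN.
  by rewrite [leLHS]/= big_geq// truncated_mzv_ge0.
rewrite /= (@big_cat_nat _ _ _ M.+1 1 N)//= lerDl sumr_ge0// => m _.
by rewrite mulr_ge0 ?truncated_mzv_ge0// invr_ge0 exprn_ge0.
Qed.

Lemma le_invXn a b m : (0 < m)%N -> (a <= b)%N -> m%:R ^- b <= m%:R ^- a :> F.
Proof.
move=> m0 ab; rewrite lef_pV2 ?posrE ?exprn_gt0 ?ltr0n//.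
by rewrite ler_weXn2l// ler1n.
Qed.

Lemma le_invn m n : (0 < m <= n)%N -> n%:R^-1 <= m%:R^-1 :> F.
Proof. by case/andP=> m0 mn; rewrite lef_pV2 ?posrE ?ltr0n ?ler_nat//; lia. Qed.

Lemma invn_sqr_le m : (0 < m)%N -> m.+1%:R ^- 2 <= m%:R^-1 - m.+1%:R^-1 :> F.
Proof.
move=> m0; have mR : m%:R != 0 :> F by rewrite pnatr_eq0 -lt0n.
have -> : m%:R^-1 - m.+1%:R^-1 = (m * m.+1)%:R^-1 :> F.
  by rewrite natrM -natr1; field; rewrite natr1 pnatr_eq0 mR.
by rewrite -natrX; apply: le_invn; lia.
Qed.

(** Telescoping of 1/n^2 <= 1/(n-1) - 1/n. *)
Lemma sum_inv_sqr_le m M : (0 < m)%N ->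
  \sum_(m.+1 <= n < M) n%:R ^- 2 <= m%:R^-1 :> F.
Proof.
move=> m0; have [Mm|mM] := leqP M m.+1; first by rewrite big_geq// invr_ge0.
rewrite -(prednK (ltn_trans (ltn0Sn m) mM)) big_add1/=.
apply: le_trans (_ : m%:R^-1 - M.-1%:R^-1 <= _); last by rewrite gerBl invr_ge0.
rewrite -opprB -(telescope_sumr (fun i => i%:R^-1)) -?sumrN; last by lia.
apply: ler_sum_nat => n /andP[mn _]; rewrite opprB.
by apply: invn_sqr_le; apply: leq_trans mn.
Qed.

(* The sum of n^-2 over n > m is at most 1/m, so the two outermost sums of
   zeta_M(a, b, s) are absorbed into the outermost one of zeta_M(b+1, s). *)
Lemma truncated_mzv_le2 M a s : (1 < a)%N -> all (leq 1) s -> Z M (a :: s) <= 2.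
Proof.
elim: s a => [|b s IHs] a a2 /=.
  move=> _; case: M => [|[|M]]; [by rewrite big_geq..|].
  rewrite big_ltn//= expr1n invr1 mulr1 [leRHS]mulr2n lerD2l.
  have /le_trans : \sum_(2 <= m < M.+2) m%:R ^- a * 1 <= \sum_(2 <= m < M.+2) m%:R ^- 2 :> F.
    by apply: ler_sum_nat => -[|m]// _; rewrite mulr1 le_invXn.
  by apply; rewrite (le_trans (sum_inv_sqr_le _ _))// invr1.
move=> /andP[b0 s0]; apply: le_trans (IHs b.+1 _ s0) => //=.
under eq_bigr do rewrite mulr_sumr.
rewrite exchange_triangle; apply: ler_sum_nat => m /andP[m0 _].
rewrite -mulr_suml mulrA exprS invfM.
rewrite ler_wpM2r ?truncated_mzv_ge0// ler_wpM2r ?invr_ge0 ?exprn_ge0//.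
apply: le_trans (sum_inv_sqr_le M m0); apply: ler_sum_nat => -[|n]// _.
exact: le_invXn.
Qed.

Lemma harmonic_number_ge0 n : 0 <= h n.
Proof. by apply: sumr_ge0 => m _; rewrite invr_ge0. Qed.

Lemma harmonic_numberS n : h n.+1 = h n + n.+1%:R^-1.
Proof. by rewrite /harmonic_number big_nat_recr. Qed.

Lemma truncated_mzv_le_harmonic M s : all (leq 1) s ->
  Z M s <= h M.-1 ^+ size s.
Proof.
elim: s M => //= a s IHs M /andP[a0 s0].
case: M => [|M]; first by rewrite big_geq// exprn_ge0// harmonic_number_ge0.
rewrite exprS {1}/harmonic_number mulr_suml.
apply: ler_sum_nat => m /andP[m0 mM].
rewrite ler_pM ?invr_ge0 ?exprn_ge0 ?truncated_mzv_ge0//.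
  by have := le_invXn m0 a0; rewrite expr1.
exact: le_trans (le_truncated_mzv _ (ltnW mM)) (IHs M.+1 s0).
Qed.

(** An algebraic substitute for the mean value inequality. *)
Lemma subX_le (x y : F) k : 0 <= y <= x ->
  x ^+ k.+1 - y ^+ k.+1 <= k.+1%:R * x ^+ k * (x - y).
Proof.
move=> /andP[y0 yx]; have x0 := le_trans y0 yx.
elim: k => [|k IHk]; first by rewrite !expr1 expr0 !mul1r.
have -> : x ^+ k.+2 - y ^+ k.+2 = x * (x ^+ k.+1 - y ^+ k.+1) + y ^+ k.+1 * (x - y).
  by rewrite !(exprS _ k.+1); ring.
have -> : k.+2%:R * x ^+ k.+1 * (x - y) =
    x * (k.+1%:R * x ^+ k * (x - y)) + x ^+ k.+1 * (x - y).
  by rewrite exprS -(natr1 k.+1); ring.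
by rewrite lerD ?ler_wpM2l ?ler_wpM2r ?subr_ge0// lerXn2r.
Qed.

(** From n to n + 1 the power h^(k+1) grows by at most (k+1) h_(n+1)^k / (n+1), which is at most
    (k+1)! by the case k. This crude bound replaces logarithmic growth. *)
Lemma harmonic_numberX_le k n : (0 < n)%N -> h n ^+ k <= k`!%:R * n%:R.
Proof.
elim: k n => [|k IHk] n n0; first by rewrite expr0 mul1r ler1n.
elim: n {n0} => [|n IHn].
  by rewrite /harmonic_number big_geq// expr0n mulr0.
rewrite -[leLHS](subrK (h n ^+ k.+1)) -[n.+1]addn1 natrD mulrDr addrC.
rewrite addn1 lerD// (le_trans (subX_le _ _))//.
  by rewrite harmonic_number_ge0/= (harmonic_numberS n) lerDl invr_ge0.
rewrite [X in _ * (X - _)]harmonic_numberS addrAC subrr add0r factS natrM.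
rewrite ler_pdivrMr ?ltr0n// mulr1 -mulrA ler_wpM2l//; exact: IHk.
Qed.

(** The harmonic difference is at most m/(M+1-m), and m^-a <= m^-2 leaves 1/(m(M+1-m)) = (1/m +
    1/(M+1-m))/(M+1), whose sum over m is 2 h_M/(M+1). *)
Lemma truncation_error_le M a s : (1 < a)%N -> all (leq 1) s ->
  0 <= truncation_error F M.+1 (a :: s) <= 2 * h M ^+ (size s).+1 / M.+1%:R.
Proof.
move=> a2 s0 /=.
have diffE m : (m < M.+1)%N ->
    h M - h (M - m) = \sum_((M - m).+1 <= n < M.+1) n%:R^-1.
  by move=> mM; rewrite sum_inv_range// ltnS leq_subr.
apply/andP; split.
  rewrite big_nat; apply: sumr_ge0 => m /andP[m0 mM].
  rewrite diffE// !mulr_ge0 ?truncated_mzv_ge0 ?invr_ge0 ?exprn_ge0//.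
  by apply: sumr_ge0 => n _; rewrite invr_ge0.
have -> : 2 * h M ^+ (size s).+1 / M.+1%:R = \sum_(1 <= m < M.+1)
    h M ^+ size s / M.+1%:R * (m%:R^-1 + (M.+1 - m)%:R^-1).
  rewrite -mulr_sumr big_split/= sum_inv_rev_offset// subn0.
  by rewrite -[\sum_(1 <= m < M.+1) m%:R^-1]/(h M) exprS; ring.
apply: ler_sum_nat => m /andP[m0 mM].
have mR : m%:R != 0 :> F by rewrite pnatr_eq0 -lt0n.
have MR : M.+1%:R != 0 :> F by rewrite pnatr_eq0.
have MmR : M.+1%:R - m%:R != 0 :> F.
  by rewrite -natrB ?(ltnW mM)// pnatr_eq0 -lt0n subn_gt0.
have -> : h M ^+ size s / M.+1%:R * (m%:R^-1 + (M.+1 - m)%:R^-1) =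
    m%:R ^- 2 * h M ^+ size s * ((M.+1 - m)%:R^-1 * m%:R).
  rewrite natrB ?(ltnW mM)//; move: (M.+1%:R) MR MmR => x xR xmR.
  by field; rewrite mR xR xmR.
rewrite diffE// !ler_pM ?mulr_ge0 ?invr_ge0 ?exprn_ge0 ?truncated_mzv_ge0//.
- by apply: sumr_ge0 => n _; rewrite invr_ge0.
- exact: le_invXn.
- exact: le_trans (le_truncated_mzv _ (ltnW mM)) (truncated_mzv_le_harmonic M.+1 s0).
(* This [m] counts the terms of the harmonic difference. *)
have {3}-> : m = (M.+1 - (M - m).+1)%N by lia.
rewrite mulr_natr -sumr_const_nat; apply: ler_sum_nat => n /andP[Mn _].
by apply: le_invn; lia.
Qed.

End HarmonicBounds.

(** * Passage to the limit *)

Section Limits.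
Variable R : realType.
Implicit Types (s : seq nat) (a M N : nat).
Local Open Scope classical_set_scope.
Local Notation Z := (@truncated_mzv R).

Definition truncated_domain n M : set (n.-tuple nat) :=
  [set m | path gtn M m /\ all (leq 1) m].
Arguments truncated_domain : clear implicits.

Definition mzv_term s (m : (size s).-tuple nat) : R :=
  \prod_(i < size s) (tnth m i)%:R ^- nth 0%N s i.
Arguments mzv_term : clear implicits.

Lemma mzv_term_ge0 s m : 0 <= mzv_term s m.
Proof. by apply: prodr_ge0 => i _; rewrite invr_ge0 exprn_ge0. Qed.

Lemma mzv_term_cons a s (x : nat) (m : (size s).-tuple nat) :
  mzv_term (a :: s) [tuple of x :: m] = x%:R ^- a * mzv_term s m.
Proof.
rewrite /mzv_term big_ord_recl/=; congr (_ * _).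
by apply: eq_bigr => i _; rewrite tnthS.
Qed.

(** The constant [c] carries the powers of the variables already fixed through the induction on
    [s]. *)
Lemma esum_truncated_domain c s M : 0 <= c ->
  \esum_(m in truncated_domain (size s) M) (c * mzv_term s m)%:E
  = (c * Z M s)%:E.
Proof.
elim: s c M => [|a s IHs] c M c0.
  rewrite /= (_ : truncated_domain 0 M = [set [tuple]]).
    by rewrite esum_set1 ?lee_fin /mzv_term ?big_ord0 ?mulr1.
  by apply/seteqP; split => m //= _; rewrite tuple0.
elim: M => [|[|M] IHM].
- rewrite (_ : truncated_domain _ _ = set0).
    by rewrite esum_set0 /= big_geq// mulr0.
  by apply/seteqP; split => m //=; case: (tupleP m) => x m' [] /andP[].
- rewrite (_ : truncated_domain _ _ = set0).
    by rewrite esum_set0 /= big_geq// mulr0.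
  apply/seteqP; split => m //=; case: (tupleP m) => x m' [].
  by move=> /= /andP[x1 _] /andP[x0 _]; lia.
(* The largest variable either equals M + 1 or lies below it, the latter being the smaller
   truncation. *)
rewrite (esumID [set m | thead m = M.+1]); last first.
  by move=> m _; rewrite lee_fin mulr_ge0// mzv_term_ge0.
have -> : truncated_domain (size (a :: s)) M.+2 `&` ~` [set m | thead m = M.+1] =
    truncated_domain (size (a :: s)) M.+1.
  apply/seteqP; split => m; case: (tupleP m) => x m' /=; rewrite theadE.
    move=> [[/andP[xM xm'] mpos] xNM]; split => //; apply/andP; split => //.
    by move: xM xNM => /=; lia.
  move=> [/andP[xM xm'] mpos]; split; last by move: xM => /=; lia.
  by split => //; apply/andP; split => //; move: xM => /=; lia.
rewrite IHM (@reindex_esum _ _ _ (truncated_domain (size s) M.+1) _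
  (fun m => [tuple of M.+1 :: m])).
  rewrite (eq_esum (b := fun m => (c * M.+1%:R ^- a * mzv_term s m)%:E)).
    rewrite IHs; last by rewrite mulr_ge0// invr_ge0 exprn_ge0.
    by rewrite -EFinD /= [in RHS]big_nat_recr//=; congr EFin; ring.
  by move=> m _; rewrite mzv_term_cons mulrA.
split.
- by move=> m [mp mpos] /=; split => //; split => //=; rewrite ltnSn.
- by move=> m m' _ _ /(congr1 (fun w => behead (tval w))) /= /val_inj.
- move=> m; case: (tupleP m) => x m' /= [[/andP[_ mp] /andP[_ mpos]]].
  rewrite theadE => xM; rewrite xM in mp *.
  by exists m'.
Qed.

Lemma esum_mzv_domain s :
  \esum_(m in mzv_domain (size s)) (mzv_term s m)%:E =
  ereal_sup (range (fun M => (Z M s)%:E)).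
Proof.
have ZE M : (Z M s)%:E = \esum_(m in truncated_domain (size s) M) (mzv_term s m)%:E.
  have := @esum_truncated_domain 1 s M ler01; rewrite mul1r => <-.
  by apply: eq_esum => m _; rewrite mul1r.
apply/eqP; rewrite eq_le; apply/andP; split; apply: ge_ereal_sup => /=.
  move=> _ [X [finX XD] <-].
  have [r Xr] := (finite_seqP X).1 finX.
  (* A bound beyond every entry of the finite set, which then lies in one truncated domain. *)
  pose M := (\max_(m <- r) \max_(i <- m) i).+1.
  apply: (@le_trans _ _ (Z M s)%:E); last by apply: ereal_sup_ubound; exists M.
  rewrite ZE; apply: ereal_sup_ubound; exists X => //; split => // m Xm.
  have [msort mpos] := XD _ Xm; split => //.
  rewrite path_min_sorted//; apply/allP => i im /=.
  have mr : m \in r by rewrite Xr in Xm.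
  rewrite /M ltnS; apply: leq_trans (leq_bigmax_seq _ mr isT).
  exact: (@leq_bigmax_seq _ (tval m) xpredT id _ im isT).
move=> _ [M _ <-]; rewrite ZE; apply: ge_ereal_sup => /= _ [X [finX XD] <-].
apply: ereal_sup_ubound; exists X => //; split => // m /XD[mp mpos]; split => //.
exact: path_sorted mp.
Qed.

(** The truncations increase and stay below 2, so the supremum is finite and [fine] returns the true
    sum. *)
Lemma cvg_truncated_mzv a s : (1 < a)%N -> all (leq 1) s ->
  Z M (a :: s) @[M --> \oo] --> mzv R (a :: s).
Proof.
move=> a2 s0.
have Znd : nondecreasing_seq (fun M => Z M (a :: s)).
  by move=> M N MN; apply: le_truncated_mzv.
have Zub : has_ubound (range (fun M => Z M (a :: s))).
  by exists 2 => _ [M _ <-]; apply: truncated_mzv_le2.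
have Zcvg := nondecreasing_cvgn Znd Zub.
rewrite /mzv (esum_mzv_domain (a :: s)).
have ZEnd : nondecreasing_seq (fun M => (Z M (a :: s))%:E).
  by move=> M N MN; rewrite lee_fin Znd.
rewrite (_ : ereal_sup _ = (sup (range (fun M => Z M (a :: s))))%:E)//.
apply: (cvg_unique _ (ereal_nondecreasing_cvgn ZEnd)) => //.
by apply: cvg_EFin => //; near=> M.
Unshelve. all: by end_near. Qed.

(** In use, [f] and [g] already have an entry at least 2 prefixed, so they converge at every
    positive index. *)
Lemma cvg_bump_sum_tail (f : nat -> seq nat -> R) (g : seq nat -> R) s :
  (forall w, all (leq 1) w -> f M w @[M --> \oo] --> g w) ->
  all (leq 1) s ->
  bump_sum (f M) s @[M --> \oo] --> bump_sum g s.
Proof.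
elim: s f g => [|a s IHs] f g fg /=; first by move=> _; apply: cvg_cst.
move=> /andP[a0 s0]; apply: cvgD; first by apply: fg => /=.
by apply: (IHs (fun M => f M \o cons a)) => // w w0; apply: fg; rewrite /= a0.
Qed.

Lemma cvg_head_split (f : nat -> seq nat -> R) (g : seq nat -> R) a s :
  (forall j, (2 <= j < a.+1)%N ->
    f M [:: j, (a.+1 - j)%N & s] @[M --> \oo] --> g [:: j, (a.+1 - j)%N & s]) ->
  head_split (f M) a s @[M --> \oo] --> head_split g a s.
Proof.
move=> fg; rewrite /head_split big_nat.
under eq_fun do rewrite big_nat.
apply: (cvg_big (op := +%R)) => //; exact: add_continuous.
Qed.

Lemma cvg_split_sum_tail (f : nat -> seq nat -> R) (g : seq nat -> R) s :
  (forall w, all (leq 1) w -> f M w @[M --> \oo] --> g w) ->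
  all (leq 1) s ->
  split_sum (f M) s @[M --> \oo] --> split_sum g s.
Proof.
elim: s f g => [|a s IHs] f g fg /=; first by move=> _; apply: cvg_cst.
move=> /andP[a0 s0]; apply: cvgD.
  apply: cvg_head_split => j /andP[j2 ja].
  by apply: fg; rewrite /= s0 andbT; lia.
by apply: (IHs (fun M => f M \o cons a)) => // w w0; apply: fg; rewrite /= a0.
Qed.

(** All indices on both sides begin with an entry at least 2, so the truncated relation passes to
    the limit, where its error vanishes. *)
Lemma mzv_hoffman a s : (1 < a)%N -> all (leq 1) s ->
  bump_sum (mzv R) (a :: s) = split_sum (mzv R) (a :: s).
Proof.
move=> a2 s0; have as0 : all (leq 1) (a :: s) by rewrite /= s0 ltnW.
have bump_cvg : bump_sum (Z M) (a :: s) @[M --> \oo] --> bump_sum (mzv R) (a :: s).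
  rewrite /=; apply: cvgD; first by apply: cvg_truncated_mzv => //; lia.
  apply: (@cvg_bump_sum_tail (fun M => Z M \o cons a)) => // w w0.
  exact: cvg_truncated_mzv.
have split_cvg : split_sum (Z M) (a :: s) @[M --> \oo] --> split_sum (mzv R) (a :: s).
  rewrite /=; apply: cvgD.
    apply: cvg_head_split => j /andP[j2 ja].
    by apply: cvg_truncated_mzv => //=; rewrite s0 andbT; lia.
  apply: (@cvg_split_sum_tail (fun M => Z M \o cons a)) => // w w0.
  exact: cvg_truncated_mzv.
set l := bump_sum (mzv R) _ in bump_cvg *; set r := split_sum (mzv R) _ in split_cvg *.
have err_cvg : truncation_error R M.+1 (a :: s) @[M --> \oo] --> l - r.
  rewrite (cvg_shiftS (fun M => truncation_error R M (a :: s))).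
  under eq_cvg do rewrite -truncated_hoffman//.
  exact: cvgB.
(* Squaring the error gives h^(2n) <= (2n)! M against M^2. *)
set C : R := 4 * ((size s).+1 * 2)`!%:R.
have C_cvg : C * harmonic M @[M --> \oo] --> 0.
  by rewrite -[0](mulr0 C); apply: cvgM; [exact: cvg_cst|exact: cvg_harmonic].
have err2_cvg : truncation_error R M.+1 (a :: s) * truncation_error R M.+1 (a :: s)
    @[M --> \oo] --> 0.
  apply: squeeze_cvgr (cvg_cst 0) C_cvg; near=> M.
  have /andP[e0 eC] := truncation_error_le R M a2 s0.
  rewrite mulr_ge0//=; apply: le_trans (ler_pM e0 e0 eC eC) _.
  have M0 : (0 < M)%N by near: M; apply: nbhs_infty_gt.
  have hC := @harmonic_numberX_le R ((size s).+1 * 2) _ M0.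
  rewrite [leLHS](_ : _ = 4 * harmonic_number R M ^+ ((size s).+1 * 2) / M.+1%:R ^+ 2).
    (* One factor 1/(M+1) absorbs the M of the bound; the other is [harmonic M]. *)
    rewrite /harmonic /C -mulrA -[leRHS]mulrA ler_wpM2l// ler_pdivrMr ?exprn_gt0//.
    rewrite expr2 mulrA mulfVK ?pnatr_eq0// in hC *.
    by rewrite (le_trans hC)// ler_wpM2l// ler_nat.
  by rewrite exprM; field.
have : (l - r) * (l - r) = 0 by apply: cvg_unique err2_cvg => //; exact: cvgM.
by move/eqP; rewrite mulf_eq0 orbb subr_eq0 => /eqP.
Unshelve. all: by end_near. Qed.

End Limits.

(** * The interpolated relation *)

Theorem theorem2p9 (R : realType) (A : comAlgType R) (t : A)
    (n : nat) (k : n.-tuple nat) (n_gt0 : (0 < n)%N)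
    (k_gt0 : forall i : 'I_n, (0 < nth 0%N k i)%N)
    (k1_ge2 : (2 <= nth 0%N k 0)%N) :
  \sum_(i < n)
     (1 + ((nth 0%N k i)%:R + (i.+1 == n)%:R - 2%:R) * t) *
     interpolated_mzv t
       (take i k ++ [:: (nth 0%N k i + 1)%N] ++ drop i.+1 k)
  = \sum_(i < n) \sum_(2 <= j < (nth 0%N k i).+1)
       interpolated_mzv t
         (take i k ++ [:: j; (nth 0%N k i + 1 - j)%N] ++ drop i.+1 k)
    + (t - t ^+ 2) *
      \sum_(i < n.-1)
         interpolated_mzv t
           (take i k ++ [:: (nth 0%N k i + nth 0%N k i.+1 + 1)%N] ++ drop i.+2 k).
Proof.
have k0 : all (leq 1) k.
  by apply/(all_nthP 0%N) => i; rewrite size_tuple => ilt; apply: (k_gt0 (Ordinal ilt)).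
have kE := size_tuple k.
have : defect t (interp t (fun w => (mzv R w)%:A)) k = 0.
  rewrite defect_interp//; case: (tval k) k0 k1_ge2 => //= a s /andP[_ s0] a2.
  apply: (@interp_from_eq0 _ _ _ 2) => // b w b2 w0.
  by rewrite bump_sum_scale split_sum_scale mzv_hoffman// subrr.
have catE (l r : seq nat) c : l ++ (c :: r) != [::] by case: l.
rewrite /defect weighted_bump_sumE split_sumE merge_sumE kE.
move/eqP; rewrite -addrA -opprD subr_eq0 => /eqP E.
rewrite (eq_bigr _ (fun i _ => congr1 ( *%R _) (interpolated_mzvE t (catE _ _ _)))).
rewrite {}E; congr (_ + _ * _).
  by apply: eq_bigr => i _; apply: eq_bigr => j _; rewrite interpolated_mzvE ?catE.
by apply: eq_bigr => i _; rewrite interpolated_mzvE ?catE.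
Qed.
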